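(* Let $p$ be a prime and let $G$ be a finite $p$-group that is a $\mathcal{DC}$-group. Then $d(G')\leqslant p$. In particular, if $d(G')=p$, then $G'\cong \mathrm{C}_p^p$.
   Context: For a group $H$, $H'$ denotes its derived (commutator) subgroup. A group $G$ is called a $\mathcal{DC}$-group if the set $\{H' \mid H\leq G\}$ of derived subgroups of all subgroups of $G$ is a chain with respect to inclusion, i.e. for all subgroups $H,K\leq G$ one has $H'\leq K'$ or $K'\leq H'$. $d(X)$ denotes the minimal cardinality of a generating set of $X$. $\mathrm{C}_p^p$ denotes the direct product of $p$ copies of the cyclic group of order $p$. *)

(* Defs.v *)
From mathcomp Require Import all_boot all_order all_algebra all_fingroup all_solvable.

Set Implicit Arguments.
Unset Strict Implicit.
Unset Printing Implicit Defensive.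

Import GroupScope.

Definition DC_group (gT : finGroupType) (G : {group gT}) : Prop :=
  forall H K : {group gT}, H \subset G -> K \subset G ->
    H^`(1) \subset K^`(1) \/ K^`(1) \subset H^`(1).

(* The law on 'Z_p is addition, and the law on {dffun ...} is that of the
   external direct product (pointwise).  'Z_p is cyclic of order maxn p 2, so
   this is the p-fold direct product of C_p when p > 1. *)
Definition Cpp (p : nat) : {group {dffun forall _ : 'I_p, 'Z_p}} :=
  [set: {dffun forall _ : 'I_p, 'Z_p}]%G.

(* Main.v *)
Require Import Defs.
From mathcomp Require Import all_boot all_order all_algebra all_fingroup all_solvable.
From mathcomp Require Import zify.

(* The chain condition yields x, y with <x, y>' = G', so let G = <x, y> and
   D = G'.  It suffices to show that |D / T| <> p^p whenever T <> 1 is normal in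
   G and D / T is elementary abelian; factoring out a maximal G-invariant
   subgroup of T, let Z = T be central of order p.  The groups
   <x, D / Z>' = [D / Z, x] and <y, D / Z>' = [D / Z, y] are comparable, so
   D / Z is, up to exchanging x and y, a uniserial module of length p for
   tau : a |-> [a, x], generated by [y, x].  Let d = tau^(p-2) [y, x] and
   w = tau d; modulo Z, [y, x^p] = w is central, and [d, y x^k] = 1 for some k.
   In G, w has order p and centralises D.  Two-generator subgroups <a, b> with
   [a, b] central of order p all have the same derived subgroup <[a, b]>.
   If [w, x] <> 1, then <w, x>' = Z, whereas one of <y x^k, x^p>' and
   <d, y x^(k+j)>', where [w, y x^(k+j)] = 1, has order p and is not Z.
   If [w, x] = 1, then <d, x>' = <w>, which forces w to be central, D to be
   abelian and, through <y, x^p>', [y, x]^p = 1.  As D = <[y, x]> [D, G],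
   and [D, G] is [D, x] or [D, y], the centraliser of x or y in D then has order
   at most p, although it contains <w> Z. *)

Set Implicit Arguments.
Unset Strict Implicit.
Unset Printing Implicit Defensive.

Import GroupScope.

(** * The endomorphism a |-> [a, x] of an abelian group normalised by x *)

Definition tau {gT : finGroupType} (x a : gT) := [~ a, x].

Section Tau.
Variables (gT : finGroupType) (A : {group gT}) (x : gT).
Hypotheses (cAA : abelian A) (nAx : x \in 'N(A)).

Lemma tau_mem a : a \in A -> tau x a \in A.
Proof. by move=> Aa; rewrite /tau commgEl groupM ?groupV ?memJ_norm. Qed.

Lemma tauM : {in A &, {morph tau x : a b / a * b}}.
Proof.
move=> a b Aa Ab; rewrite /tau commMgJ; congr (_ * _).
by rewrite conjgE (centsP cAA _ (tau_mem Aa) b Ab) mulKg.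
Qed.
Canonical tau_morphism := Morphism tauM.

Lemma tau1 : tau x 1 = 1.
Proof. exact: comm1g. Qed.

Lemma tauV a : a \in A -> tau x a^-1 = (tau x a)^-1.
Proof. by move=> Aa; rewrite -(morphV tau_morphism). Qed.

Lemma tauX a n : a \in A -> tau x (a ^+ n) = tau x a ^+ n.
Proof. by move=> Aa; rewrite -(morphX tau_morphism). Qed.

Lemma iter_tau_mem i a : a \in A -> iter i (tau x) a \in A.
Proof. by move=> Aa; elim: i => //= i; apply: tau_mem. Qed.

Lemma iter_tauM i : {in A &, {morph iter i (tau x) : a b / a * b}}.
Proof.
by move=> a b Aa Ab; elim: i => //= i ->; rewrite tauM // iter_tau_mem.
Qed.

Lemma iter_tauX i a n : a \in A -> iter i (tau x) (a ^+ n) = iter i (tau x) a ^+ n.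
Proof.
by move=> Aa; elim: i => //= i ->; rewrite tauX // iter_tau_mem.
Qed.

Lemma prod_mulg_abelian n (f g : nat -> gT) :
    (forall i, f i \in A) -> (forall i, g i \in A) ->
  (\prod_(i < n) f i) * (\prod_(i < n) g i) = \prod_(i < n) (f i * g i).
Proof.
move=> Af Ag; elim: n => [|n IHn]; first by rewrite !big_ord0 mulg1.
rewrite !big_ord_recr /= -IHn !mulgA; congr (_ * _); rewrite -!mulgA.
congr (_ * _); apply: (centsP cAA) => //; exact: group_prod.
Qed.

(* Writing A additively, [y, x^n] = (((1 + tau)^n - 1) / tau) [y, x]. *)
Lemma commgX_tau y (n N : nat) : [~ y, x] \in A -> n <= N ->
  [~ y, x ^+ n] = \prod_(i < N) iter i (tau x) [~ y, x] ^+ 'C(n, i.+1).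
Proof.
move=> Ac; set c := [~ y, x] in Ac *.
have Ai i m : iter i (tau x) c ^+ m \in A by rewrite groupX ?iter_tau_mem.
elim: n => [|n IHn] ltnN.
  by rewrite commg1 big1 // => i _; rewrite bin0n expg0.
rewrite expgSr commgMJ -/c conjg_mulR IHn 1?ltnW //.
set P := \prod_(i < N) _.
have -> : [~ P, x] = \prod_(i < N) iter i.+1 (tau x) c ^+ 'C(n, i.+1).
  rewrite -/(tau x P) /P; elim: (N) => [|M IH]; first by rewrite !big_ord0 tau1.
  rewrite !big_ord_recr /= tauM ?group_prod // IH; congr (_ * _).
  by rewrite tauX ?iter_tau_mem.
have AP : P \in A by apply: group_prod.
rewrite mulgA (centsP cAA _ Ac _ AP) -mulgA.
(* Here [c] becomes the factor of index 0 of the shifted product, whose top factor has exponent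
   ['C(n, N)], zero as [n < N]. Pascal's rule then merges both products. *)
have -> : c * \prod_(i < N) iter i.+1 (tau x) c ^+ 'C(n, i.+1)
          = \prod_(i < N) iter i (tau x) c ^+ 'C(n, i).
  transitivity (\prod_(i < N.+1) iter i (tau x) c ^+ 'C(n, i)).
    by rewrite big_ord_recl /= bin0 expg1.
  by rewrite big_ord_recr /= (bin_small ltnN) expg0 mulg1.
rewrite /P (prod_mulg_abelian N (f := fun i => iter i (tau x) c ^+ 'C(n, i.+1))
  (g := fun i => iter i (tau x) c ^+ 'C(n, i))) //.
by apply: eq_bigr => i _; rewrite -expgD binS.
Qed.

Lemma commgXp_tau y p : prime p -> [~ y, x] \in A ->
    (forall a, a \in A -> tau x a ^+ p = 1) ->
  [~ y, x ^+ p] = [~ y, x] ^+ p * iter p.-1 (tau x) [~ y, x].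
Proof.
move=> p_pr Ac tp; rewrite (commgX_tau Ac (leqnn p)).
case: p p_pr tp => [|[|q]] // p_pr tp.
rewrite big_ord_recl big_ord_recr /= bin1 binn expg1.
congr (_ * _); rewrite big1 ?mul1g // => i _.
have -> : bump 0 i = i.+1 by [].
have /dvdnP[k ->] : q.+2 %| 'C(q.+2, i.+2).
  by apply: prime_dvd_bin => //; rewrite !ltnS ltn_ord.
by rewrite mulnC expgM tp ?iter_tau_mem // expg1n.
Qed.

Lemma card_tau_morphim (R : {group gT}) : R \subset A ->
  (#|R :&: 'ker tau_morphism| * #|tau_morphism @* R|)%N = #|R|.
Proof. by move=> sRA; rewrite card_morphim (setIidPr sRA) LagrangeI. Qed.

(** The factorisation bounds |A| by p |tau A|, while |A| = |ker tau| |tau A|. *)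
Lemma card_ker_tau c p : prime p -> c ^+ p = 1 ->
  A \subset <[c]> * (tau x @: A) -> #|'ker tau_morphism| <= p.
Proof.
move=> p_pr cp1 sA.
have oc : #|<[c]>| <= p.
  by rewrite -orderE dvdn_leq ?prime_gt0 // order_dvdn cp1.
have defim : tau x @: A = tau_morphism @* A by rewrite morphimEdom.
have := dvdn_leq _ (dvdn_cardMg <[c]> (tau_morphism @* A)).
rewrite muln_gt0 !cardG_gt0 => /(_ isT) h.
rewrite defim in sA; have := leq_trans (subset_leq_card sA) h.
rewrite -[in X in X <= _](card_tau_morphim (R := A)) // leq_pmul2r ?cardG_gt0 //.
rewrite (setIidPr _) ?subsetIl // => /leq_trans; exact.
Qed.

(** This is [A, x, ..., x] with [i] entries [x], built from morphic images so that orders can be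
    compared step by step. *)
Fixpoint tau_series i : {group gT} :=
  if i is j.+1 then (tau_morphism @* tau_series j)%G else A.

Lemma tau_series_sub i : tau_series i \subset A.
Proof.
elim: i => //= i sRA; apply/subsetP=> _ /morphimP[a Aa _ ->].
exact: tau_mem.
Qed.

Lemma mem_tau_series i a : a \in A -> iter i (tau x) a \in tau_series i.
Proof.
move=> Aa; elim: i => //= i IHi; apply: (mem_morphim tau_morphism) => //.
exact: iter_tau_mem.
Qed.

Lemma tau_seriesP i v : v \in tau_series i -> exists2 a, a \in A & v = iter i (tau x) a.
Proof.
elim: i v => [v Av|i IHi _ /morphimP[a Aa /IHi[b Ab ->] ->]]; first by exists v.
by exists b.
Qed.

Lemma tau_series_norm i : x \in 'N(tau_series i).
Proof.
have sx j : {in tau_series j, forall v, v ^ x \in tau_series j}.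
  move=> _ /tau_seriesP[a Aa ->]; rewrite -[_ ^ x]/(_ ^ x) conjg_mulR.
  rewrite groupM ?mem_tau_series // -/(tau x _) -iterS iterSr.
  by rewrite mem_tau_series ?tau_mem.
by rewrite inE; apply/subsetP=> _ /imsetP[v Rv ->]; apply: sx.
Qed.

(** Each step divides the order by exactly [p]: by at most [p] because of [card_ker_tau], and by
    more than 1 because the p-group A<x> is nilpotent. *)
Lemma card_tau_series c p i : prime p -> p.-group A -> p.-elt x ->
    c ^+ p = 1 -> #|A| = (p ^ p)%N -> A \subset <[c]> * (tau x @: A) ->
  i <= p -> #|tau_series i| = (p ^ (p - i))%N.
Proof.
move=> p_pr pA px cp1 oA sA; have ker_p := card_ker_tau p_pr cp1 sA.
elim: i => [|i IHi] ltip; first by rewrite subn0.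
have {}IHi := IHi (ltnW ltip).
have lb : p ^ (p - i) <= p * #|tau_series i.+1|.
  rewrite -IHi -(card_tau_morphim (tau_series_sub i)) leq_mul2r.
  by rewrite (leq_trans _ ker_p) ?orbT ?subset_leq_card ?subsetIr.
have ub : #|tau_series i.+1| < #|tau_series i|.
  have nx : <[x]> \subset 'N(A) by rewrite cycle_subG.
  have pAx : p.-group (A <*> <[x]>).
    by rewrite norm_joinEr // pgroupM pA.
  apply: proper_card; apply: sub_proper_trans (_ : [~: tau_series i, <[x]>] \proper _).
    apply/subsetP=> _ /morphimP[a Aa Ra ->].
    by rewrite mem_commg ?cycle_id.
  apply: (nil_comm_properl (pgroup_nil pAx)).
  - by rewrite (subset_trans (tau_series_sub i)) ?joing_subl.
  - by rewrite -cardG_gt1 IHi -(expn0 p) ltn_exp2l ?prime_gt1 // subn_gt0.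
  by rewrite subsetI joing_subr cycle_subG tau_series_norm.
have /p_natP[m om] : p.-nat #|tau_series i.+1|.
  by apply: pgroupS pA; apply: tau_series_sub.
move: lb ub; rewrite om IHi -expnS leq_exp2l ?ltn_exp2l ?prime_gt1 // => lb ub.
by congr (_ ^ _)%N; apply/eqP; rewrite eqn_leq; lia.
Qed.
End Tau.

(** * Commutators in two-generator groups and the chain condition on G' *)

Lemma der1_gen_sub {gT : finGroupType} (X : {set gT}) (N : {group gT}) :
    X \subset 'N(N) -> {in X &, forall a b, [~ a, b] \in N} ->
  <<X>>^`(1) \subset N.
Proof.
move=> nNX cXX; apply: der1_min; first by rewrite gen_subG.
rewrite quotient_gen // abelian_gen abelianE quotient_cents2 // gen_subG.
by apply/subsetP=> _ /imset2P[a b Xa Xb ->]; apply: cXX.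
Qed.

Lemma commg_gen_sub {gT : finGroupType} (A X : {set gT}) (N : {group gT}) :
    A \subset 'N(N) -> X \subset 'N(N) ->
    {in A & X, forall a b, [~ a, b] \in N} ->
  [~: A, <<X>>] \subset N.
Proof.
move=> nNA nNX cAX; rewrite -quotient_cents2 ?gen_subG //.
rewrite quotient_gen // cent_gen quotient_cents2 // gen_subG.
by apply/subsetP=> _ /imset2P[a b Aa Xb ->]; apply: cAX.
Qed.

Lemma der1_gen2 {gT : finGroupType} (G : {group gT}) x y :
  G :=: <<[set x; y]>> -> G^`(1) \subset <[ [~ y, x] ]> * [~: G^`(1), G].
Proof.
move=> defG.
have [Gx Gy] : x \in G /\ y \in G by rewrite defG !mem_gen // !inE eqxx ?orbT.
have Dc : [~ y, x] \in G^`(1) by rewrite mem_commg.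
have nsDG : G^`(1) <| G := der_normal 1 G.
have sND : [~: G^`(1), G] \subset G^`(1) by rewrite commg_subl normal_norm.
have nNc : <[ [~ y, x] ]> \subset 'N([~: G^`(1), G]).
  rewrite cycle_subG (subsetP _ _ Dc) // (subset_trans (normal_sub nsDG)) //.
  exact: commg_normr.
rewrite -norm_joinEl //; set K := _ <*> _.
have sNK : [~: G^`(1), G] \subset K by rewrite joing_subr.
have sKD : K \subset G^`(1) by rewrite join_subG cycle_subG Dc.
have nKG : G \subset 'N(K).
  by rewrite -commg_subl (subset_trans _ sNK) // commSg.
have Kc : [~ y, x] \in K by rewrite mem_gen // inE cycle_id.
rewrite {1}defG; apply: der1_gen_sub => [|a b].
  by apply: subset_trans nKG; rewrite defG subset_gen.
by rewrite !inE => /orP[] /eqP-> /orP[] /eqP->;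
   rewrite ?commgg ?group1 // -invg_comm groupV.
Qed.

(** As [A] is abelian, the image of [tau x] is a subgroup; [A] centralises it and [x] normalises it,
    so it suffices to look at commutators of generators. *)
Lemma der1_join_tau {gT : finGroupType} (A : {group gT}) x :
  abelian A -> x \in 'N(A) -> (A <*> <[x]>)^`(1) = tau x @: A.
Proof.
move=> cAA nAx; have nR := tau_series_norm cAA nAx 1.
have sR := tau_series_sub cAA nAx 1.
have defR : tau x @: A = tau_series cAA nAx 1.
  by rewrite /= morphimEdom.
apply/eqP; rewrite eqEsubset; apply/andP; split; last first.
  apply/subsetP=> _ /imsetP[a Aa ->]; apply: mem_commg.
    exact: subsetP (joing_subl _ _) _ Aa.
  exact: subsetP (joing_subr _ _) _ (cycle_id x).
have cAR : A \subset 'C(tau_series cAA nAx 1).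
  by rewrite (subset_trans cAA) ?centS.
have Rt a : a \in A -> [~ a, x] \in tau_series cAA nAx 1.
  by move=> Aa; rewrite -defR; apply: imset_f.
rewrite joing_idr defR; apply: der1_gen_sub => [|a b].
  by rewrite subUset sub1set nR andbT cents_norm.
rewrite !inE => /orP[Aa|/eqP->] /orP[Ab|/eqP->]; last by rewrite commgg.
- by have /commgP/eqP-> := centsP cAA _ Aa _ Ab.
- exact: Rt.
by rewrite -invg_comm groupV; apply: Rt.
Qed.

(** Conjugation by [y] replaces [x] by x [x, y], and the factor [x, y] acts trivially on the abelian
    group G'. *)
Lemma tauJ {gT : finGroupType} (G : {group gT}) x y a :
    abelian G^`(1) -> x \in G -> y \in G -> a \in G^`(1) ->
  tau x a ^ y = tau x (a ^ y).
Proof.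
move=> cDD Gx Gy Da.
have nD := subsetP (normal_norm (der_normal 1 G)).
have Du : [~ x, y] \in G^`(1) by rewrite mem_commg.
have Db : a ^ y \in G^`(1) by rewrite memJ_norm ?nD.
have Dt : tau x (a ^ y) \in G^`(1).
  by apply: (tau_mem (A := [group of G^`(1)]) (nD _ Gx) Db).
rewrite /tau conjRg (conjg_mulR x) commgMJ.
have /commgP/eqP-> := centsP cDD _ Db _ Du; rewrite mul1g.
by rewrite conjgE (centsP cDD _ Dt _ Du) mulKg.
Qed.

(* [tau x @: A] is the derived subgroup of [A <*> <[x]>], so the chain
   condition makes it comparable with [tau y @: A]. *)
Lemma DC_der1_tau {gT : finGroupType} (G : {group gT}) x y :
    G :=: <<[set x; y]>> -> DC_group G -> abelian G^`(1) ->
  [~: G^`(1), G] \subset tau x @: G^`(1) \/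
  [~: G^`(1), G] \subset tau y @: G^`(1).
Proof.
move=> defG dcG cDD.
have [Gx Gy] : x \in G /\ y \in G by rewrite defG !mem_gen // !inE eqxx ?orbT.
have nD := subsetP (normal_norm (der_normal 1 G)).
have sDG := normal_sub (der_normal 1 G).
suffices main u v : u \in G -> v \in G -> G :=: <<[set u; v]>> ->
    tau v @: G^`(1) \subset tau u @: G^`(1) ->
    [~: G^`(1), G] \subset tau u @: G^`(1).
  have [] := dcG [group of G^`(1) <*> <[x]>] [group of G^`(1) <*> <[y]>].
  - by rewrite join_subG sDG cycle_subG.
  - by rewrite join_subG sDG cycle_subG.
  - rewrite /= !der1_join_tau ?nD // => s; right; apply: main s => //.
    by rewrite setUC.
  by rewrite /= !der1_join_tau ?nD // => s; left; apply: main s.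
(* The larger image R = [G', u] is normalised by [u], and by [v] thanks to [tauJ]; it contains
   [a, u] and [a, v] for all a in G', hence [G', G]. *)
move=> Gu Gv defG' svu.
have defR : tau u @: G^`(1) = tau_series (A := [group of G^`(1)]) cDD (nD _ Gu) 1.
  by rewrite /= morphimEdom.
have cDR : G^`(1) \subset 'C(tau u @: G^`(1)).
  rewrite (subset_trans cDD) ?centS // defR; exact: tau_series_sub.
rewrite {2}defG' defR; apply: commg_gen_sub.
- by rewrite -defR cents_norm.
- apply/subsetP=> z; rewrite !inE -defR => /orP[]/eqP->; last first.
    apply/subsetP=> _ /imsetP[_ /imsetP[a Da ->] ->].
    by rewrite (tauJ (G := G)) // imset_f // memJ_norm ?nD.
  have := tau_series_norm (A := [group of G^`(1)]) cDD (nD _ Gu) 1.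
  by rewrite -defR inE.
move=> a z Da; rewrite -defR !inE => /orP[]/eqP->; first exact: imset_f.
by apply: (subsetP svu); apply: imset_f.
Qed.

(** By [tauJ], [tau x] commutes with conjugation by [y] on G', hence with [tau y]. *)
Lemma iter_tau_comm {gT : finGroupType} (G : {group gT}) x y a i :
    abelian G^`(1) -> x \in G -> y \in G -> a \in G^`(1) ->
  [~ iter i (tau x) a, y] = iter i (tau x) [~ a, y].
Proof.
move=> cDD Gx Gy Da.
have nD := subsetP (normal_norm (der_normal 1 G)).
elim: i => //= i <-; have Dv := iter_tau_mem (A := [group of G^`(1)]) (nD _ Gx) i Da.
set v := iter i _ a in Dv *.
have nDx := nD _ Gx; pose D := [group of G^`(1)].
transitivity ((tau x v)^-1 * tau x (v ^ y)).
  by rewrite -(tauJ (G := G)).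
rewrite commgEl [RHS](tauM (A := D)) ?groupV ?memJ_norm ?nD //.
by rewrite (tauV (A := D)).
Qed.

(** * Elementary abelian derived subgroup of order p^p: the uniserial action of x *)

Section ElementaryDerived.
Variables (gT : finGroupType) (G : {group gT}) (x y : gT) (p : nat).
Hypotheses (p_pr : prime p) (pG : p.-group G) (defG : G :=: <<[set x; y]>>).
Hypotheses (abD : p.-abelem G^`(1)) (oD : #|G^`(1)| = (p ^ p)%N).
Hypothesis sDx : [~: G^`(1), G] \subset tau x @: G^`(1).

Let d := iter p.-2 (tau x) [~ y, x].
Let w := tau x d.

(** By [card_tau_series], tau^p kills G' and tau^(p-1) does not; as G' = <[y, x]> tau(G'), the image
    of tau^(p-1) is <w>. *)
Lemma abelem_der1_tau :
  [/\ w != 1, w \in 'C(G), [~ y, x ^+ p] = w & exists k, [~ d, y * x ^+ k] = 1].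
Proof.
have [Gx Gy] : x \in G /\ y \in G by rewrite defG !mem_gen // !inE eqxx ?orbT.
have nD := subsetP (normal_norm (der_normal 1 G)).
have [_ cDD expD] := and3P abD; have nDx := nD _ Gx.
have Dc : [~ y, x] \in G^`(1) by rewrite mem_commg.
have p1 a : a \in G^`(1) -> a ^+ p = 1 by move=> Da; have [_] := abelemP p_pr abD; apply.
have Dt := tau_mem (A := [group of G^`(1)]) nDx.
have sA : G^`(1) \subset <[ [~ y, x] ]> * (tau x @: G^`(1)).
  by rewrite (subset_trans (der1_gen2 defG)) ?mulgS.
have pD : p.-group G^`(1) by apply: pgroupS pG; apply: der_sub.
have card_R := card_tau_series (A := [group of G^`(1)]) cDD nDx p_pr pD
  (mem_p_elt pG Gx) (p1 _ Dc) oD sA.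
have Rp v : v \in G^`(1) -> iter p (tau x) v = 1.
  move=> Dv; have := mem_tau_series (A := [group of G^`(1)]) cDD nDx p Dv.
  have: #|tau_series (A := [group of G^`(1)]) cDD nDx p| == 1%N.
    by rewrite card_R ?subnn.
  by rewrite -trivg_card1 => /eqP->; move/set1P.
have def_w : w = iter p.-1 (tau x) [~ y, x].
  by rewrite /w /d -iterS; case: (p) p_pr => [|[|q]].
have Sp : p.-1.+1 = p by rewrite prednK ?prime_gt0.
have SSp : p.-2.+1 = p.-1 by case: (p) p_pr => [|[|q]].
have tau_img v : v \in tau x @: G^`(1) -> iter p.-1 (tau x) v = 1.
  by case/imsetP=> u Du ->; rewrite -iterSr Sp Rp.
have cyc v : v \in G^`(1) -> iter p.-1 (tau x) v \in <[w]>.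
  move/(subsetP sA)=> /mulsgP[_ u /cycleP[n ->] im_u ->].
  have Du : u \in G^`(1) by case/imsetP: im_u => b Db ->; apply: Dt.
  rewrite (iter_tauM (A := [group of G^`(1)])) ?groupX //.
  rewrite (iter_tauX (A := [group of G^`(1)])) // (tau_img u) // mulg1 -def_w.
  exact: mem_cycle.
have im_comm v g : v \in G^`(1) -> g \in G -> [~ v, g] \in tau x @: G^`(1).
  by move=> Dv Gg; apply: (subsetP sDx); apply: mem_commg.
have cw : w \in 'C(G).
  (* [w, g] = tau^(p-1) [[y, x], g], and the inner commutator already lies in the image of tau. *)
  rewrite defG cent_gen; apply/centP=> g; rewrite !inE => gxy.
  have Gg : g \in G by case/orP: gxy => /eqP->.
  apply/commgP; rewrite def_w (iter_tau_comm (G := G)) // tau_img //.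
  exact: im_comm.
have ntw : w != 1.
  apply/eqP=> w1; have := card_R p.-1; rewrite leq_pred => /(_ isT).
  have -> : p - p.-1 = 1%N by have := prime_gt0 p_pr; lia.
  have -> : tau_series (A := [group of G^`(1)]) cDD nDx p.-1 = 1%G.
    apply/trivGP; apply/subsetP=> _ /tau_seriesP[v Dv ->].
    by have := cyc v Dv; rewrite w1 cycle1.
  by rewrite cards1 expn1 => p1'; have := p_pr; rewrite -p1'.
split=> //.
  rewrite (commgXp_tau (A := [group of G^`(1)])) // ?p1 ?mul1g // => a Da.
  by rewrite p1 ?Dt.
have : [~ d, y] \in <[w]>.
  rewrite (iter_tau_comm (G := G)) //; have /imsetP[u Du ->] := im_comm _ _ Dc Gy.
  by rewrite -iterSr SSp cyc.
(* Since [d, x^k] = w^k, choosing [k] with w^k = [d, y]^-1 makes the two contributions cancel. *)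
rewrite -groupV => /cycleP[k def_k]; exists k.
have cwxk : commute w (x ^+ k) by apply: commuteX; apply: (centP cw).
rewrite commgMJ commgX; last by apply/esym/(centP cw).
have -> : [~ d, y] = (w ^+ k)^-1 by rewrite -def_k invgK.
by rewrite conjVg conjXg conjgE cwxk mulKg mulgV.
Qed.
End ElementaryDerived.

(** * Inheritance and first use of the chain condition *)

Lemma DC_subgroup {gT : finGroupType} (G H : {group gT}) :
  H \subset G -> DC_group G -> DC_group H.
Proof.
by move=> sHG dcG A B sA sB; apply: dcG; apply: subset_trans sHG.
Qed.

Lemma DC_quotient {gT : finGroupType} (G N : {group gT}) :
  N <| G -> DC_group G -> DC_group (G / N)%G.
Proof.
move=> nsNG dcG A B sAG sBG.
have [H defA sNH sHG] := inv_quotientS nsNG sAG.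
have [K defB sNK sKG] := inv_quotientS nsNG sBG.
have nHN := subset_trans sHG (normal_norm nsNG).
have nKN := subset_trans sKG (normal_norm nsNG).
rewrite defA defB -!(quotient_der 1) //.
by case: (dcG H K sHG sKG) => s; [left | right]; apply: quotientS.
Qed.

(** Each commutator is central in the group generated by its two entries, so it generates the
    derived subgroup; comparable subgroups of the same order coincide. *)
Lemma DC_cycle_commg {gT : finGroupType} (G : {group gT}) p a b a' b' :
    DC_group G -> a \in G -> b \in G -> a' \in G -> b' \in G ->
    commute a [~ a, b] -> commute b [~ a, b] ->
    commute a' [~ a', b'] -> commute b' [~ a', b'] ->
    #[ [~ a, b] ] = p -> #[ [~ a', b'] ] = p ->
  <[ [~ a, b] ]> = <[ [~ a', b'] ]>.
Proof.
move=> dcG Ga Gb Ga' Gb' ca cb ca' cb' ou ou'.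
have der u v : commute u [~ u, v] -> commute v [~ u, v] ->
    (<[u]> <*> <[v]>)^`(1) = <[ [~ u, v] ]>.
  move=> cu cv; apply: der1_joing_cycles.
  rewrite joing_idl joing_idr cent_gen; apply/centP=> g; rewrite !inE.
  by case/orP=> /eqP->; apply: esym.
have [] := dcG [group of <[a]> <*> <[b]>] [group of <[a']> <*> <[b']>].
- by rewrite join_subG !cycle_subG Ga.
- by rewrite join_subG !cycle_subG Ga'.
- rewrite /= !der // => s; apply/eqP; rewrite eqEcard s.
  by rewrite -!orderE ou ou' leqnn.
rewrite /= !der // => s; apply/esym/eqP; rewrite eqEcard s.
by rewrite -!orderE ou ou' leqnn.
Qed.

(** * Central extensions by a subgroup of order p *)

Section CentralExtension.
Variables (gT : finGroupType) (G Z : {group gT}) (x y : gT) (p : nat).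
Hypotheses (p_pr : prime p) (pG : p.-group G) (defG : G :=: <<[set x; y]>>).
Hypotheses (dcG : DC_group G) (nsZG : Z <| G) (sZD : Z \subset G^`(1)).
Hypotheses (oZ : #|Z| = p) (abDZ : p.-abelem (G^`(1) / Z)).
Hypothesis (oDZ : #|G^`(1) / Z| = (p ^ p)%N).

Lemma mem_gens : x \in G /\ y \in G.
Proof. by rewrite defG !mem_gen // !inE eqxx ?orbT. Qed.

Lemma sub_center_Z : Z \subset 'Z(G).
Proof.
have ntZ : Z :!=: 1 by rewrite -cardG_gt1 oZ prime_gt1.
have := meet_center_nil (pgroup_nil pG) nsZG ntZ.
by apply: contraR => ?; rewrite prime_TIg ?oZ.
Qed.

Lemma coset_commg a b : a \in G -> b \in G ->
  coset Z [~ a, b] = [~ coset Z a, coset Z b].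
Proof.
by move=> Ga Gb; rewrite morphR ?(subsetP (normal_norm nsZG)).
Qed.

Lemma coset_iter_tau i a : a \in G ->
  coset Z (iter i (tau x) a) = iter i (tau (coset Z x)) (coset Z a).
Proof.
have [Gx _] := mem_gens; move=> Ga; elim: i => //= i <-.
rewrite coset_commg //; elim: i => //= i IHi; exact: groupR.
Qed.

Lemma quotient_gens : (G / Z) = <<[set coset Z x; coset Z y]>>.
Proof.
have [Gx Gy] := mem_gens; have nZ := subsetP (normal_norm nsZG).
rewrite defG quotient_gen; last first.
  by apply/subsetP=> g /set2P[] ->; apply: nZ.
by rewrite /quotient morphimU /= !morphim_set1 /= ?nZ.
Qed.

Lemma mem_Z_coset a : a \in G -> (a \in Z) = (coset Z a == 1).
Proof.
move=> Ga; apply/idP/eqP=> [/coset_id // | ].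
exact: coset_idr (subsetP (normal_norm nsZG) _ Ga).
Qed.

(** This pulls [abelem_der1_tau] for G / Z back to G, where equalities become membership in [Z]. The
    witness is d = tau^(p-2) [y, x]. *)
Lemma der1_tau_lift :
    [~: (G / Z)^`(1), G / Z] \subset tau (coset Z x) @: (G / Z)^`(1) ->
  exists2 d, d \in G^`(1) & let w := [~ d, x] in
  [/\ w = iter p.-1 (tau x) [~ y, x], w \notin Z,
      forall g, g \in G -> [~ w, g] \in Z,
      w^-1 * [~ y, x ^+ p] \in Z & exists k, [~ d, y * x ^+ k] \in Z].
Proof.
move=> sDx; have [Gx Gy] := mem_gens; have nZ := subsetP (normal_norm nsZG).
have defD := quotient_der 1 (normal_norm nsZG).
have SSp : p.-2.+1 = p.-1 by case: (p) p_pr => [|[|q]].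
have oDZ' : #|(G / Z)^`(1)| = (p ^ p)%N by rewrite -defD.
have abDZ' : p.-abelem (G / Z)^`(1) by rewrite -defD.
have [] := abelem_der1_tau p_pr (quotient_pgroup Z pG) quotient_gens abDZ' oDZ' sDx.
have Dc : [~ y, x] \in G^`(1) by rewrite mem_commg.
set d := iter p.-2 (tau x) [~ y, x].
have Dd : d \in G^`(1).
  apply: (iter_tau_mem (A := [group of G^`(1)])) => //.
  exact: subsetP (normal_norm (der_normal 1 G)) _ Gx.
have Gd : d \in G by apply: subsetP (der_sub 1 G) _ Dd.
have Gw : [~ d, x] \in G by apply: groupR.
have Gc : [~ y, x] \in G by apply: groupR.
rewrite -(coset_commg Gy Gx) -(coset_iter_tau _ Gc) -/d.
rewrite -[tau _ _]/[~ _, _] -(coset_commg Gd Gx).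
move=> ntw cw eyx [k ek]; exists d => //; split.
- by rewrite -SSp.
- by rewrite mem_Z_coset.
- move=> g Gg; rewrite mem_Z_coset ?groupR // coset_commg //.
  by apply/commgP; apply: (centP cw _ (mem_quotient Z Gg)).
- rewrite mem_Z_coset ?groupM ?groupV ?groupR ?groupX //.
  rewrite morphM ?nZ ?groupV ?groupR ?groupX // morphV ?nZ //.
  by rewrite /= (coset_commg Gy (groupX _ Gx)) morphX ?nZ //= eyx mulVg.
exists k; rewrite mem_Z_coset ?groupR ?groupM ?groupX //.
rewrite coset_commg ?groupM ?groupX // morphM ?nZ ?groupX //.
by rewrite /= morphX ?nZ // ek.
Qed.

Hypothesis sDx :
  [~: (G / Z)^`(1), G / Z] \subset tau (coset Z x) @: (G / Z)^`(1).

Lemma der1_tau_extension_absurd : False.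
Proof.
have [Gx Gy] := mem_gens; have [d Dd] := der1_tau_lift sDx.
set w := [~ d, x]; case=> def_w ntw wZ; move=> Zz0 [k Zdk].
have Ew : [~ d, x] = w by []; clearbody w.
have sDG := subsetP (der_sub 1 G : G^`(1) \subset G).
have nD := subsetP (normal_norm (der_normal 1 G)).
have Gd := sDG _ Dd; have Dw : w \in G^`(1) by rewrite -Ew mem_commg.
have Gw := sDG _ Dw; have [sZG _] := andP nsZG.
have zc z g : z \in Z -> g \in G -> commute z g.
  move=> Zz Gg; have /centerP[_] := subsetP sub_center_Z z Zz; exact.
have cz z g : z \in Z -> g \in G -> commute g z by move=> Zz Gg; apply/esym/zc.
have zJ z g : z \in Z -> g \in G -> z ^ g = z.
  by move=> Zz Gg; rewrite conjgE (zc _ _ Zz Gg) mulKg.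
have zp z : z \in Z -> z ^+ p = 1.
  by move=> Zz; apply/eqP; rewrite -order_dvdn -oZ order_dvdG.
have Dp a : a \in G^`(1) -> a ^+ p \in Z.
  move=> Da; rewrite mem_Z_coset ?groupX ?sDG //.
  rewrite morphX ?(subsetP (normal_norm nsZG)) ?sDG //=.
  have [_ ->] := abelemP p_pr abDZ; rewrite ?mem_quotient //.
have conjw g : g \in G -> w ^ g = w * [~ w, g] by rewrite conjg_mulR.
(* All [w, g] are central, so g h and h g conjugate [w] alike; hence [g, h] fixes [w]. *)
have cwD h : h \in G^`(1) -> commute w h.
  suffices: G^`(1) \subset 'C[w].
    by move/subsetP=> sC Dh; apply/esym; apply/cent1P; apply: sC.
  rewrite gen_subG; apply/subsetP=> _ /imset2P[g {}h Gg Gh ->].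
  have conj2 g1 g2 : g1 \in G -> g2 \in G -> w ^ (g1 * g2) = w ^ (g2 * g1).
    have aux a b : a \in G -> b \in G -> w ^ (a * b) = w * [~ w, b] * [~ w, a].
      move=> Ga Gb; rewrite conjgM conjw // conjMg conjw //; congr (_ * _).
      by rewrite zJ ?wZ.
    move=> G1 G2; rewrite !aux // -(mulgA w).
    by rewrite (zc _ _ (wZ _ G2) (groupR Gw G1)) mulgA.
  apply/cent1P/commute_sym/commgP; rewrite -conjg_fix; apply/eqP.
  rewrite commgEl conjgE !mulgA -(mulgA _ g h) conjgM conj2 ?groupV //.
  by rewrite !conjgM !conjgKV.
(* d^p lies in [Z], so d^p = (d^p)^x = (d w)^p = d^p w^p. *)
have wp : w ^+ p = 1.
  have cdw : commute d w by apply/esym/cwD.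
  have := zJ _ _ (Dp _ Dd) Gx; rewrite conjXg conjg_mulR Ew expgMn // => h.
  by apply: (mulgI (d ^+ p)); rewrite h mulg1.
have cwg g : g \in G -> [~ w, g] = 1 -> commute w g by move=> _ /eqP/commgP.
have up j z : z \in Z -> (w ^+ j * z) ^+ p = 1.
  move=> Zz; rewrite expgMn; last by apply: cz; rewrite ?groupX.
  by rewrite -expgM mulnC expgM wp expg1n zp // mulg1.
have cu j z g : z \in Z -> g \in G -> commute w g -> commute g (w ^+ j * z).
  move=> Zz Gg cwg'; apply: commuteM; last by apply: cz.
  by apply: commuteX; apply: esym.
have order_p u : u ^+ p = 1 -> u != 1 -> #[u] = p by apply: nt_prime_order.
have n1Z u : u \notin Z -> u != 1 by apply: contraNneq => ->; apply: group1.
have ow : #[w] = p by apply: order_p wp (n1Z _ ntw).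
have wz_notin z : z \in Z -> w * z \notin Z by move=> Zz; rewrite groupMr.
have [wx1 | ntwx] := eqVneq [~ w, x] 1; last first.
  (* Here [<w, x>' = Z], so no [<[a, b]>] of order [p] other than [Z] occurs. *)
  have owx : #[ [~ w, x] ] = p by apply: order_p ntwx; apply/zp/wZ.
  have cyc_Z : <[ [~ w, x] ]> = Z.
    apply/eqP; rewrite eqEcard cycle_subG wZ // oZ -orderE.
    by rewrite owx leqnn.
  have inZ a b : a \in G -> b \in G -> commute a [~ a, b] -> commute b [~ a, b] ->
      [~ a, b] ^+ p = 1 -> [~ a, b] \in Z.
    move=> Ga Gb ca cb ep; have [-> | nte] := eqVneq [~ a, b] 1; first exact: group1.
    rewrite -cyc_Z (DC_cycle_commg (p := p) dcG Gw Gx Ga Gb) ?cycle_id ?owx //.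
    - exact: (cz _ _ (wZ _ Gx) Gw).
    - exact: (cz _ _ (wZ _ Gx) Gx).
    exact: order_p.
  set y1 := y * x ^+ k in Zdk.
  have Gy1 : y1 \in G by rewrite groupM ?groupX.
  (* [y1, x^p] is the conjugate of [y, x^p] by x^k, and [y, x^p] is [w] times an element of [Z];
     conjugating [w] adds the factor [w, x^k]. *)
  have [z1 Zz1 Ey1] : exists2 z1, z1 \in Z & [~ y1, x ^+ p] = w * z1.
    exists ([~ w, x ^+ k] * (w^-1 * [~ y, x ^+ p])).
      by rewrite groupM ?wZ ?groupX.
    rewrite commMgJ.
    have /commgP/eqP-> : commute (x ^+ k) (x ^+ p) by apply: commuteX2.
    rewrite mulg1 mulgA -conjg_mulR -{1}(mulKVg w [~ y, x ^+ p]) conjMg.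
    by rewrite [X in _ * X]zJ // groupX.
  (* If [w] commutes with [y1], it also commutes with x^p because [w, x]^p = 1; then [y1, x^p] = w
     z1 is an excluded commutator outside [Z]. *)
  have [wy1 | ntwy1] := eqVneq [~ w, y1] 1.
    have cwy1 := cwg _ Gy1 wy1.
    have cwxp : commute w (x ^+ p).
      apply: cwg; rewrite ?groupX // commgX; first by rewrite zp ?wZ.
      exact: (cz _ _ (wZ _ Gx) Gx).
    have [cu1 cu2] := (cu 1%N _ _ Zz1 Gy1 cwy1, cu 1%N _ _ Zz1 (groupX p Gx) cwxp).
    have := inZ y1 (x ^+ p) Gy1 (groupX _ Gx); rewrite Ey1 => h.
    by apply: (negP (wz_notin _ Zz1)); apply: h => //; apply: (up 1%N).
  (* Otherwise, as [w, x] generates [Z], some y1 x^j centralises [w]; the excluded commutator is now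
     [d, y1 x^j], which is w^j modulo [Z]. *)
  have [j Ej] : exists j, [~ w, y1]^-1 = [~ w, x] ^+ j.
    by apply/cycleP; rewrite cyc_Z groupV wZ.
  have Gyj : y1 * x ^+ j \in G by rewrite groupM ?groupX.
  have cwyj : commute w (y1 * x ^+ j).
    apply: cwg => //; rewrite commgMJ zJ ?wZ ?groupX //.
    by rewrite commgX -?Ej ?mulVg //; apply: (cz _ _ (wZ _ Gx) Gx).
  have dxj n : exists2 z, z \in Z & [~ d, x ^+ n] = w ^+ n * z.
    elim: n => [|n [z Zz IHn]]; first by exists 1; rewrite ?commg1 ?mulg1.
    exists ([~ w, x] ^+ n * z); first by rewrite groupM ?groupX ?wZ.
    rewrite expgSr commgMJ Ew IHn conjMg (zJ z) // conjXg conjw // expgMn.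
      by rewrite expgS !mulgA.
    exact: (cz _ _ (wZ _ Gx) Gw).
  have [z Zz Ez] := dxj j.
  have Edj : [~ d, y1 * x ^+ j] = w ^+ j * (z * [~ d, y1]).
    by rewrite commgMJ Ez (zJ _ _ Zdk) ?groupX // (mulgA _ z).
  have Zz2 : z * [~ d, y1] \in Z by rewrite groupM.
  have := inZ d (y1 * x ^+ j) Gd Gyj; rewrite Edj groupMr //.
  move=> /(_ (cu _ _ _ Zz2 Gd (cwD _ Dd)) (cu _ _ _ Zz2 Gyj cwyj) (up _ _ Zz2)).
  (* [w, x]^j is nontrivial, so [p] does not divide [j] and w^j generates <w>; with w^j in [Z], [w]
     would be there too. *)
  apply/negP; apply: contra ntw => Zwj; rewrite -cycle_subG.
  have : generator <[w]> (w ^+ j).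
    rewrite generator_coprime ow prime_coprime //.
    apply: contra ntwy1 => /dvdnP[m Em]; rewrite -invg_eq1 Ej Em mulnC expgM.
    by rewrite zp ?wZ // expg1n.
  by rewrite /generator => /eqP->; rewrite cycle_subG.
(* Here [<d, x>' = <w>], so [Z] is not the derived subgroup of any subgroup. *)
have cwx := cwg _ Gx wx1.
have eq_w a b : a \in G -> b \in G -> commute a [~ a, b] -> commute b [~ a, b] ->
    [~ a, b] ^+ p = 1 -> [~ a, b] != 1 -> <[w]> = <[ [~ a, b] ]>.
  move=> Ga Gb ca cb ep nte; rewrite -Ew.
  apply: (DC_cycle_commg (p := p) dcG) => //; rewrite ?Ew //.
  - exact: (esym (cwD _ Dd)).
  exact: order_p.
(* A nontrivial commutator in [Z] would be central of order [p], so it would generate <w> and put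
   [w] in [Z]. *)
have triv a b : a \in G -> b \in G -> [~ a, b] \in Z -> [~ a, b] = 1.
  move=> Ga Gb Zu; apply/eqP; apply: contraR ntw => ntu.
  have eqwu := eq_w _ _ Ga Gb (cz _ _ Zu Ga) (cz _ _ Zu Gb) (zp _ Zu) ntu.
  by rewrite -cycle_subG eqwu cycle_subG.
have cw g : g \in G -> commute w g by move=> Gg; exact: cwg Gg (triv _ _ Gw Gg (wZ _ Gg)).
have cDD : abelian G^`(1).
  have sD'Z : [~: G^`(1), G^`(1)] \subset Z.
    have nZD := subset_trans (der_sub 1 G) (normal_norm nsZG).
    by rewrite -quotient_cents2 //; have [] := and3P abDZ.
  apply/centsP=> a Da b Db; apply/commgP/eqP; apply: triv; rewrite ?sDG //.
  exact: subsetP sD'Z _ (mem_commg Da Db).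
set c := [~ y, x] in def_w.
have Dc : c \in G^`(1) by rewrite mem_commg.
(* [y, x^p] = w c^p with c^p in [Z]. It generates <w> by [eq_w], so c^p is in <w>; if nontrivial,
   c^p would generate <w> and put [w] in [Z]. *)
have cp1 : c ^+ p = 1.
  have Zcp := Dp _ Dc.
  have Eu : [~ y, x ^+ p] = w ^+ 1 * c ^+ p.
    rewrite (commgXp_tau (A := [group of G^`(1)])) ?nD //.
      by rewrite -/c -def_w expg1; apply/esym/cw; rewrite groupX ?sDG.
    move=> a Da; rewrite -(tauX (A := [group of G^`(1)])) ?nD //.
    apply/eqP/commgP; apply: zc Gx; exact: Dp.
  have Gxp := groupX p Gx; have cu1 := cu 1%N _ _ Zcp Gy (cw _ Gy).
  have cu2 := cu 1%N _ _ Zcp Gxp (cw _ Gxp).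
  have ntu : w ^+ 1 * c ^+ p != 1 by apply: n1Z; apply: wz_notin.
  have := eq_w y (x ^+ p) Gy (groupX p Gx); rewrite Eu.
  move=> /(_ cu1 cu2 (up 1%N _ Zcp) ntu) eqwu.
  apply/eqP; apply: contraR ntw => ntcp.
  have w_cp : c ^+ p \in <[w]>.
    have : w ^+ 1 * c ^+ p \in <[w]> by rewrite eqwu cycle_id.
    by rewrite groupMl // cycle_id.
  have eqwc : <[c ^+ p]> = <[w]>.
    apply/eqP; rewrite eqEcard cycle_subG w_cp -!orderE ow order_p ?leqnn //.
    exact: zp.
  by rewrite -cycle_subG -eqwc cycle_subG.
(* If G' = <c> [G', v], then c^p = 1 bounds the centraliser of [v] in G' by [p]. It contains [Z], so
   it equals [Z], yet it contains [w]. *)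
suffices main v : v \in G -> ~ [~: G^`(1), G] \subset tau v @: G^`(1).
  by have [] := DC_der1_tau defG dcG cDD; apply: main.
move=> Gv sDv; have nDv := nD _ Gv.
have sA : [group of G^`(1)] \subset <[c]> * (tau v @: [group of G^`(1)]).
  by rewrite (subset_trans (der1_gen2 defG)) ?mulgS.
have := card_ker_tau (A := [group of G^`(1)]) cDD nDv p_pr cp1 sA.
set K := 'ker _ => leKp.
have mem_K a : a \in G^`(1) -> commute a v -> a \in K.
  by move=> Da cav; rewrite !inE Da; apply/commgP.
have sZK : Z \subset K.
  apply/subsetP=> z Zz; apply: mem_K; first exact: subsetP sZD _ Zz.
  exact: zc.
have eqZK : Z :=: K by apply/eqP; rewrite eqEcard sZK oZ.
by move/negP: ntw; apply; rewrite eqZK mem_K //; apply: cw.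
Qed.
End CentralExtension.

(** * Reduction of the general case to central extensions *)

Lemma DC_no_central_extension {gT : finGroupType} (G Z : {group gT}) x y p :
    prime p -> p.-group G -> G :=: <<[set x; y]>> -> DC_group G ->
    Z <| G -> Z \subset G^`(1) -> #|Z| = p -> p.-abelem (G^`(1) / Z) ->
  #|G^`(1) / Z| != (p ^ p)%N.
Proof.
move=> p_pr pG defG dcG nsZG sZD oZ abDZ; apply/eqP=> oDZ.
(* Either generator may have the larger image in the quotient, so the section is applied to both
   orders of the pair. *)
have defG' : G :=: <<[set y; x]>> by rewrite setUC.
have cDZ : abelian (G / Z)^`(1).
  by rewrite -(quotient_der 1) ?normal_norm //; have [] := and3P abDZ.
have defGZ := quotient_gens defG nsZG.
have [] := DC_der1_tau defGZ (DC_quotient nsZG dcG) cDZ.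
  exact: der1_tau_extension_absurd p_pr pG defG dcG nsZG sZD oZ abDZ oDZ.
exact: der1_tau_extension_absurd p_pr pG defG' dcG nsZG sZD oZ abDZ oDZ.
Qed.

(** A nontrivial [T] contains a normal subgroup L of G with index [p] in [T]; then G / L and T / L
    contradict [DC_no_central_extension]. *)
Lemma DC_der1_kernel_trivial {gT : finGroupType} (G T : {group gT}) x y p :
    prime p -> p.-group G -> G :=: <<[set x; y]>> -> DC_group G ->
    T <| G -> T \subset G^`(1) -> p.-abelem (G^`(1) / T) ->
    #|G^`(1) / T| = (p ^ p)%N ->
  T :=: 1.
Proof.
move=> p_pr pG defG dcG nsTG sTD abDT oDT; apply/eqP/idPn=> ntT.
have pT : p.-group T := pgroupS (normal_sub nsTG) pG.
have [L [sLT nsLG oL]] := normal_pgroup pG nsTG (leq_pred (logn p #|T|)).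
have nLG := normal_norm nsLG; have sLD := subset_trans sLT sTD.
have nsLD : L <| G^`(1) := normalS sLD (der_sub 1 G) nsLG.
have nsTD : T <| G^`(1) := normalS sTD (der_sub 1 G) nsTG.
have isoDT := third_isog sLT nsLD nsTD.
have oTL : #|T / L| = p.
  have lT : 0 < logn p #|T|.
    rewrite lt0n; apply: contra ntT => /eqP l0.
    by rewrite trivg_card1 (card_pgroup pT) l0.
  have nsLT : L <| T := normalS sLT (normal_sub nsTG) nsLG.
  rewrite -(divg_normal nsLT) (card_pgroup pT) oL -(prednK lT) expnS /=.
  by rewrite mulnK // expn_gt0 prime_gt0.
have := @DC_no_central_extension _ (G / L)%G (T / L)%G _ _ p p_pr
  (quotient_pgroup L pG) (quotient_gens defG nsLG) (DC_quotient nsLG dcG).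
rewrite /= -(quotient_der 1) // quotient_normal // quotientS // oTL.
rewrite (isog_abelem isoDT) (card_isog isoDT) oDT eqxx.
by move=> /(_ isT isT erefl abDT).
Qed.

(** A pair whose derived subgroup has maximal order works: by the chain condition that subgroup
    contains every <a, b>', hence every commutator. *)
Lemma DC_der1_gen2 {gT : finGroupType} (G : {group gT}) : DC_group G ->
  exists x, exists y, let H := <<[set x; y]>> in
    H \subset G /\ H^`(1) = G^`(1).
Proof.
move=> dcG; pose f (u : gT * gT) := #|<<[set u.1; u.2]>>^`(1)|.
have G11 : ((1 : gT), (1 : gT)) \in setX G G by rewrite inE /= group1.
have [[x y] /setXP[/= Gx Gy] max_xy] := arg_maxnP f G11.
have gen2 a b : a \in G -> b \in G -> <<[set a; b]>> \subset G.
  by move=> Ga Gb; rewrite gen_subG subUset !sub1set Ga.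
exists x, y; split; first exact: gen2.
apply/eqP; rewrite eqEsubset dergS ?gen2 //= gen_subG.
apply/subsetP=> _ /imset2P[a b Ga Gb ->].
have abM : [~ a, b] \in <<[set a; b]>>^`(1).
  by rewrite mem_commg // mem_gen // !inE eqxx ?orbT.
have [s | s] := dcG [group of <<[set x; y]>>] [group of <<[set a; b]>>]
  (gen2 _ _ Gx Gy) (gen2 _ _ Ga Gb); last exact: subsetP s _ abM.
have Gab : (a, b) \in setX G G by rewrite inE /= Ga.
have le_card := max_xy _ Gab; rewrite /f /= in le_card.
have /eqP eqM : <<[set x; y]>>^`(1) == <<[set a; b]>>^`(1) by rewrite eqEcard s.
by move: abM; rewrite -eqM.
Qed.

(** Representatives of generators of the Frattini quotient generate D, since the Frattini subgroup
    consists of nongenerators. *)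
Lemma grank_quotient_Phi {gT : finGroupType} (D : {group gT}) :
  'm(D) <= 'm(D / 'Phi(D)).
Proof.
have [B genB <-] := grank_witness (D / 'Phi(D)).
have nPhi : 'Phi(D) <| D := Phi_normal D.
have sB : B \subset D / 'Phi(D) by rewrite -genB subset_gen.
have reprB b : b \in B -> repr b \in D.
  move=> Bb; have := subsetP sB _ Bb; rewrite -{1}(coset_reprK b) => h.
  have : repr b \in coset 'Phi(D) @*^-1 (D / 'Phi(D)).
    by apply/morphpreP; split; first exact: repr_coset_norm.
  by rewrite quotientGK.
set X := (fun b : coset_of 'Phi(D) => repr b) @: B.
have sXD : X \subset D by apply/subsetP=> _ /imsetP[b Bb ->]; apply: reprB.
have genX : <<X>> = D.
  apply: Phi_nongen; apply/eqP; rewrite eqEsubset join_subG Phi_sub sXD /=.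
  rewrite -(quotientSGK (normal_norm nPhi)) ?joing_subl // -genB gen_subG.
  apply/subsetP=> b Bb; rewrite -(coset_reprK b) mem_quotient //.
  by apply/mem_gen/setUP; right; apply/imsetP; exists b.
by rewrite -{1}genX (leq_trans (grank_min X)) ?leq_imset_card.
Qed.

Lemma DC_der1_large {gT : finGroupType} (G : {group gT}) p :
    prime p -> p.-group G -> DC_group G -> p <= 'm(G^`(1)) ->
  p.-abelem G^`(1) /\ #|G^`(1)| = (p ^ p)%N.
Proof.
move=> p_pr pG dcG; have [x [y [sHG <-]]] := DC_der1_gen2 dcG.
set H := [group of <<[set x; y]>>]; set D := [group of H^`(1)] => le_p.
have pH : p.-group H := pgroupS sHG pG; have dcH := DC_subgroup sHG dcG.
have pD : p.-group D := pgroupS (der_sub 1 H) pH.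
have nsPhi : 'Phi(D) <| H by apply: gFnormal_trans; apply: der_normal.
have abV := Phi_quotient_abelem pD; set V := D / 'Phi(D) in abV.
have nsVH : V <| H / 'Phi(D) by apply/quotient_normal/der_normal.
have le_pV : p <= logn p #|V|.
  rewrite -rank_abelem // -grank_abelian ?(abelem_abelian abV) //.
  exact: leq_trans le_p (grank_quotient_Phi D).
(* [N] has index p^p in [V]. Its preimage [T] gives an elementary abelian D / T of order p^p, so
   [DC_der1_kernel_trivial] forces T = 1. *)
have [N [sNV nsN oN]] := normal_pgroup (quotient_pgroup _ pH) nsVH
  (leq_subr p (logn p #|V|)).
have [T defN sPhiT nsTH] := inv_quotientN nsPhi nsN.
have sTD : T \subset D.
  rewrite -(quotientSGK _ (Phi_sub D)) -?defN //.
  exact: subset_trans (normal_sub nsTH) (normal_norm nsPhi).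
have nsTD : T <| D := normalS sTD (der_sub 1 H) nsTH.
have isoDT := third_isog sPhiT (Phi_normal D) nsTD.
have abDT : p.-abelem (D / T) by rewrite -(isog_abelem isoDT) quotient_abelem.
have oDT : #|D / T| = (p ^ p)%N.
  have nsNV : N <| V := normalS sNV (normal_sub nsVH) nsN.
  rewrite -(card_isog isoDT) -defN -divg_normal //= oN.
  rewrite [X in X %/ _](card_pgroup (abelem_pgroup abV)).
  by rewrite -expnB ?prime_gt0 ?leq_subr // subKn.
have T1 : T = 1%G.
  apply/trivGP.
  by rewrite (DC_der1_kernel_trivial (x := x) (y := y) p_pr pH _ dcH nsTH).
rewrite T1 in abDT oDT.
have iso1 := quotient1_isog D.
by rewrite (isog_abelem iso1) (card_isog iso1).
Qed.

(** * Identification with the direct power and conclusion *)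

(** These two properties determine the group up to isomorphism. *)
Lemma Cpp_abelem p : prime p -> p.-abelem (Cpp p) /\ #|Cpp p| = (p ^ p)%N.
Proof.
move=> p_pr; have p_gt1 := prime_gt1 p_pr.
have oZp : #|'Z_p| = p by rewrite card_ord Zp_cast.
split.
  apply/abelemP=> //; split.
    apply/centsP=> f _ g _; apply/ffunP=> i.
    by rewrite /commute !dffunM /= [LHS]GRing.addrC.
  move=> f _; apply/ffunP=> i.
  have -> n : (f ^+ n) i = (f i) ^+ n.
    by elim: n => [|n IHn]; rewrite ?ffunE // !expgS dffunM IHn.
  by rewrite ffunE; have := expg_cardG (in_setT (f i)); rewrite cardsT oZp.
rewrite cardsT card_dep_ffun.
have /all_pred1P-> : all (pred1 p) [seq #|'Z_p| | _ : 'I_p].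
  by apply/allP=> _ /imageP[i _ ->] /=; rewrite oZp.
rewrite size_image card_ord.
have prod_nseq q n : foldr muln 1%N (nseq n q) = (q ^ n)%N.
  by elim: n => //= n ->; rewrite expnS.
exact: prod_nseq.
Qed.

Theorem theorem1p2 (p : nat) (gT : finGroupType) (G : {group gT}) :
  prime p -> p.-group G -> DC_group G ->
  'm(G^`(1)) <= p /\ ('m(G^`(1)) = p -> G^`(1) \isog Cpp p).
Proof.
move=> p_pr pG dcG.
have [lt_p | ge_p] := ltnP 'm(G^`(1)) p.
  by split=> [|eq_p]; [apply: ltnW | rewrite eq_p ltnn in lt_p].
have [abD oD] := DC_der1_large p_pr pG dcG ge_p.
split.
  by rewrite grank_abelian ?(abelem_abelian abD) // (rank_abelem abD) oD pfactorK.
have [abC oC] := Cpp_abelem p_pr.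
by rewrite (isog_abelem_card _ abD) abC oC oD eqxx.
Qed.
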